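(* Let $G$ be a bridgeless cubic graph, let $M$ be a perfect matching of $G$, and let $A,B,C,D$ be four pairwise disjoint $M$-balanced matchings satisfying: (i) every odd cycle of $G\setminus M$ has, for each of the four sets $A,B,C,D$, exactly one vertex incident with an edge of that set, and at least two of the (edge-disjoint) paths into which these four vertices divide the cycle have odd length; (ii) for every even cycle of $G\setminus M$, at least two of the sets $A,B,C,D$ have no edge incident to a vertex of the cycle. Then $\tau(G)\le 5$.
   Context: For a bridgeless cubic graph $G$, $\tau(G)$ is the minimum number of perfect matchings of $G$ whose union is $E(G)$. Given a perfect matching $M$ of $G$, a set $A\subseteq E(G)$ is an $M$-balanced matching if there is a perfect matching $M'$ of $G$ with $A=M\cap M'$. The graph $G\setminus M$ obtained by deleting the edges of $M$ is a $2$-factor, i.e. a disjoint union of cycles. *)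

(* Defs.v *)
From mathcomp Require Import all_boot.

Set Implicit Arguments.
Unset Strict Implicit.
Unset Printing Implicit Defensive.

(* Finite graphs, parallel edges allowed. Loops are excluded; this is no
   restriction here, because a cubic graph with a loop has a bridge. *)
Record graph := Graph {
  vertex : finType;
  edge : finType;
  ends : edge -> {set vertex};
  card_ends : forall e, #|ends e| = 2
}.

Section GraphNotions.

Variable G : graph.

Implicit Types (e : edge G) (F M N A : {set edge G}) (v x y : vertex G).
Implicit Types (c : seq (vertex G * edge G)).

Definition cubic : bool :=
  [forall v : vertex G, #|[set e | v \in ends e]| == 3].

(* Adjacency in the spanning subgraph with edge set F. *)
Definition adj F : rel (vertex G) :=
  fun x y => [exists e in F, ends e == [set x; y]].

Definition bridge e : bool :=
  n_comp (adj [set: edge G]) (vertex G) < n_comp (adj [set~ e]) (vertex G).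

Definition bridgeless : bool := [forall e, ~~ bridge e].

Definition perfect_matching N : bool :=
  [forall v, #|[set e in N | v \in ends e]| == 1].

Definition pm_cover (P : {set {set edge G}}) : bool :=
  [forall N in P, perfect_matching N] && (cover P == [set: edge G]).

(* If the perfect matchings of G do not cover its edges, the minimum is not
   defined and tau takes the default value #|{set edge G}| = 2 ^ #|edge G|;
   for a nonempty cubic graph this is at least 8, see tau_le5. *)
Definition tau : nat :=
  #|[arg min_(P < [set: {set edge G}] | pm_cover P) #|P|]|.

Definition balanced M A : bool :=
  [exists N, perfect_matching N && (A == M :&: N)].

(* A cycle v_0 e_0 v_1 e_1 ... v_{n-1} e_{n-1} v_0 with all edges in F is the
   sequence of the pairs (v_i, e_i), where e_i joins v_i to its cyclic
   successor. A cycle of length 2 is a pair of parallel edges. *)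
Definition cycle_in F c : bool :=
  [&& c != [::], uniq (unzip1 c), uniq (unzip2 c), all (mem F) (unzip2 c)
    & cycle (fun d d' => ends d.2 == [set d.1; d'.1]) c].

Definition touched A : {set vertex G} := \bigcup_(e in A) ends e.

(* Number of vertices in X on the cycle c. *)
Definition hits (X : {set vertex G}) c : nat := count (mem X) (unzip1 c).

(* Length of the path that starts at the vertex x of the cycle c and follows c
   up to the next vertex in X (possibly x itself, after a full turn). *)
Definition arc_length (X : {set vertex G}) c x : nat :=
  let s := unzip1 c in (find (mem X) (behead (rot (index x s) s))).+1.

(* Lengths of the paths into which the vertices in X divide the cycle c. *)
Definition arc_lengths (X : {set vertex G}) c : seq nat :=
  [seq arc_length X c x | x <- unzip1 c & x \in X].

Lemma tau_spec P : pm_cover P ->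
  (exists2 Q, pm_cover Q & #|Q| = tau) /\ (forall Q, pm_cover Q -> tau <= #|Q|).
Proof.
move=> covP.
have -> : tau = #|[arg min_(Q < P | pm_cover Q) #|Q|]|.
  rewrite /tau /arg_min /extremum; case: pickP => //= none.
  case: (arg_minnP (fun Q : {set {set edge G}} => #|Q|) covP) => Q covQ minQ.
  by case/andP: (none Q); split=> //; apply/forall_inP.
by case: arg_minnP => // Q covQ minQ; split=> //; exists Q.
Qed.

Lemma tau_le5 : cubic ->
  reflect (exists2 P, pm_cover P & #|P| <= 5) (tau <= 5).
Proof.
move=> /forallP cubG; apply: (iffP idP) => [|[P covP leP5]]; last first.
  by have [_ /(_ P covP) leP] := tau_spec covP; apply: leq_trans leP leP5.
have [P covP _ | nocov] := pickP (fun P => pm_cover P && (#|P| <= 5)).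
  by case/andP: covP => covP leP5; exists P.
have [P covP le5 | none] := pickP pm_cover.
  have [[Q covQ eqQ] _] := tau_spec covP.
  by exists Q; rewrite // eqQ.
have [v _ | noV] := pickP (fun _ : vertex G => true).
  rewrite /tau /arg_min /extremum; case: pickP => [Q /andP[]|_ /=].
    by rewrite none.
  rewrite cardsT -cardsT -powersetT card_powerset cardsT leqNgt => /negP[].
  apply: (@leq_trans (2 ^ 3)) => //.
  by rewrite leq_exp2l // -(eqP (cubG v)) max_card.
move: (none set0); rewrite /pm_cover.
have -> : [forall N in set0, perfect_matching N] by apply/forall_inP=> N; rewrite inE.
case/eqP; apply/setP=> e; have: 0 < #|ends e| by rewrite card_ends.
by case/card_gt0P=> v; have := noV v.
Qed.

End GraphNotions.

(* Main.v *)
(* Let N_X be a perfect matching with X = M :&: N_X, for X in {A, B, C, D}. Among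
   all such choices, take one for which M and the four N_X together cover as many
   edges as possible, and suppose that the edge e is not covered. It lies on a
   cycle c of G \ M.

   If c is odd, number its vertices v_0, ..., v_{n-1} so that e joins v_{n-1} to
   v_0. Each N_X alternates along c except at the vertex of c touched by X, and
   it misses e; hence that vertex has an even index. So the four vertices have
   even indices, and every path between two consecutive ones has even length,
   except possibly the path that contains e. This contradicts (i).

   If c is even, two of the sets, X and Y say, do not touch c, so N_X and N_Y
   restrict to perfect matchings of c. Replacing N_Y on c by the complement of
   N_X covers all of c and changes nothing elsewhere, against maximality. *)

Require Import Defs.
From mathcomp Require Import all_boot.

Set Implicit Arguments.
Unset Strict Implicit.
Unset Printing Implicit Defensive.

(** * Involutions given by two-element fibers *)

Section Mate.

Variables (T : finType) (U : eqType) (g : T -> U).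

(** Under [fiber2] the [pick] always succeeds, and [mate] swaps the two points of each fiber. *)
Definition mate x := odflt x [pick y | (g y == g x) && (y != x)].

Hypothesis fiber2 : forall x, #|[set y | g y == g x]| = 2.

Lemma mate_neq_fiber x : mate x != x /\ g (mate x) = g x.
Proof.
rewrite /mate; case: pickP => [y /andP[/eqP-> ->] // | none].
have: 1 < #|[set y | g y == g x]| by rewrite fiber2.
rewrite (cardsD1 x) inE eqxx ltnS => /card_gt0P[y].
by rewrite !inE andbC none.
Qed.

Lemma mate_neq x : mate x != x. Proof. by case: (mate_neq_fiber x). Qed.

Lemma mate_fiber x : g (mate x) = g x. Proof. by case: (mate_neq_fiber x). Qed.

Lemma mateP x y : g y = g x -> y = x \/ y = mate x.
Proof.
move=> gyx; apply/pred2P; rewrite -in_set2.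
suff -> : [set x; mate x] = [set z | g z == g x] by rewrite inE gyx.
apply/eqP; rewrite eqEcard fiber2 cards2 eq_sym mate_neq andbT.
by apply/subsetP=> z /set2P[] ->; rewrite inE ?mate_fiber.
Qed.

Lemma mateK : involutive mate.
Proof.
move=> x; have [xm | //] := mateP (esym (mate_fiber x)).
by have := mate_neq x; rewrite -xm eqxx.
Qed.

End Mate.

(* The middle of an orbit segment from x to s x would be a fixed point of s or
   of r. *)
Lemma reflection_notin_orbit (T : finType) (s r : T -> T) x :
  involutive s -> involutive r ->
  (forall y, s y != y) -> (forall y, r y != y) ->
  ~~ fconnect (s \o r) x (s x).
Proof.
move=> sK rK s_neq r_neq; set f := s \o r.
apply/negP=> /iter_findex; move: (findex _ _ _) => k.
have [n] := ubnP k; elim: n k x => // n IHn [|[|k]] x; rewrite ltnS => lt_kn.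
- by move/esym/eqP; rewrite (negPf (s_neq x)).
- by move/(inv_inj sK)/eqP; rewrite (negPf (r_neq x)).
rewrite iterS iterSr => /(inv_inj sK)/(canRL rK) fk.
by apply: (IHn k (f x)); [apply: ltnW | rewrite fk /f /= sK].
Qed.

(** * Perfect matchings, and the parity of arcs *)

Section Graph.

Variable G : graph.

Implicit Types (e : edge G) (v : vertex G) (N X : {set edge G}).

Lemma perfect_matchingP N :
  reflect (forall v, exists2 e, (e \in N) && (v \in ends e) &
             forall e', e' \in N -> v \in ends e' -> e' = e)
          (perfect_matching N).
Proof.
apply: (iffP forallP) => [pmN v | pmN v].
  have /cards1P[e Ee] := pmN v.
  have: e \in [set e in N | v \in ends e] by rewrite Ee set11.
  rewrite inE => eN; exists e => // e' e'N ve'.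
  by apply/set1P; rewrite -Ee inE e'N.
have [e eN e_uniq] := pmN v; apply/cards1P; exists e; apply/setP=> e'.
rewrite !inE; apply/andP/eqP => [[e'N ve']| ->]; first exact: e_uniq.
exact/andP.
Qed.

(** An arc that does not wrap around the end of the list has as length the difference of two even
    indices. Only the arc starting at the last vertex of [V] wraps around. *)
Lemma count_odd_arcs_le1 (V : {set vertex G}) (c : seq (vertex G * edge G)) :
    uniq (unzip1 c) ->
    (forall v, v \in V -> v \in unzip1 c -> ~~ odd (index v (unzip1 c))) ->
  count odd (arc_lengths V c) <= 1.
Proof.
rewrite /arc_lengths /arc_length; set s := unzip1 c => uniq_s even_s.
rewrite count_map; set a := preim _ _.
(* As [y] comes later, the arc from [x] stops inside the list, at index [(index x s).+1 + k]. This
   index and that of [x] are even, so the length [k.+1] is even. Hence two odd arcs cannot start at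
   different vertices. *)
have a_last x y : x \in V -> x \in s -> y \in V -> y \in s ->
    index x s < index y s -> ~~ a x.
  move=> xV xs yV ys lt_xy; rewrite /a /= negbK /rot drop_index //=.
  have hasV : has (mem V) (drop (index x s).+1 s).
    apply/hasP; exists y => //; rewrite -(nth_index x ys) -(subnKC lt_xy).
    by rewrite -nth_drop mem_nth // size_drop ltn_sub2r ?index_mem //
               (leq_ltn_trans lt_xy) ?index_mem.
  rewrite find_cat hasV; set k := find _ _.
  have lt_k : (index x s).+1 + k < size s.
    by rewrite -ltn_subRL -size_drop /k -has_find.
  have := nth_find x hasV; rewrite -/k nth_drop => zV.
  have := even_s _ zV (mem_nth x lt_k).
  by rewrite index_uniq // addSn /= oddD negbK (negPf (even_s x xV xs)).
have [/hasP[z] | ] := boolP (has a [seq x <- s | x \in V]); last first.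
  by rewrite has_count -leqNgt => /leq_trans->.
rewrite mem_filter => /andP[zV zs] az.
have le1 : count (pred1 z) [seq x <- s | x \in V] <= 1.
  by rewrite count_uniq_mem ?filter_uniq // leq_b1.
apply: leq_trans le1; rewrite -!size_filter; apply: uniq_leq_size => [|x].
  by rewrite !filter_uniq.
rewrite !mem_filter => /and3P[ax xV xs]; rewrite xV xs /= andbT; apply/eqP.
have [lt_xz|lt_zx|eq_xz] := ltngtP (index x s) (index z s).
- by have /negP[] := a_last x z xV xs zV zs lt_xz.
- by have /negP[] := a_last z x zV zs xV xs lt_zx.
by rewrite -(nth_index x xs) eq_xz nth_index.
Qed.

(** * Traversing the cycles of the 2-factor by darts *)

Section TwoFactor.

Variable M : {set edge G}.

(** An edge of the 2-factor with a direction of travel, away from [tail]. [turn] swaps the two darts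
    at a vertex and [flip] the two on an edge, so each cycle yields two orbits of [next], one per
    direction. *)
Definition dart := {d : vertex G * edge G | (d.2 \notin M) && (d.1 \in ends d.2)}.

Implicit Types d : dart.

Definition tail d := (val d).1.
Definition line d := (val d).2.

Definition turn := mate tail.
Definition flip := mate line.
Definition next d := turn (flip d).

Definition dart_cycle d := map val (orbit next d).

Hypotheses (cubG : cubic G) (pmM : perfect_matching M).

Lemma lineP d : line d \notin M. Proof. by case/andP: (valP d). Qed.

Lemma tail_ends d : tail d \in ends (line d).
Proof. by case/andP: (valP d). Qed.

Lemma dart_eq d d' : tail d = tail d' -> line d = line d' -> d = d'.
Proof.
by case: d d' => [[v e] p] [[v' e'] p'] /= ? ?; apply: val_inj; congr (_, _).
Qed.

Lemma dart_of v e : e \notin M -> v \in ends e ->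
  exists2 d, tail d = v & line d = e.
Proof.
move=> eM ve.
by exists (exist _ (v, e) (introT (@andP (e \notin M) (v \in ends e)) (conj eM ve))).
Qed.

(** Of the three edges at a vertex, exactly one lies in [M]. *)
Lemma card_tail d : #|[set d' | tail d' == tail d]| = 2.
Proof.
have inj_line : {in [set d' | tail d' == tail d] &, injective line}.
  by move=> x y; rewrite !inE => /eqP tx /eqP ty; apply: dart_eq; rewrite tx.
rewrite -(card_in_imset inj_line).
have /eqP := forallP cubG (tail d); rewrite -(cardsID M).
have -> : [set e | tail d \in ends e] :&: M = [set e in M | tail d \in ends e].
  by apply/setP=> e; rewrite !inE andbC.
rewrite (eqP (forallP pmM _)) add1n => -[<-]; apply: eq_card => e.
apply/imsetP/idP => [[x] | ]; rewrite !inE.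
  by move/eqP=> <- ->; rewrite lineP tail_ends.
by case/andP=> eM /(dart_of eM)[x tx <-]; exists x; rewrite ?inE ?tx.
Qed.

Lemma card_line d : #|[set d' | line d' == line d]| = 2.
Proof.
have inj_tail : {in [set d' | line d' == line d] &, injective tail}.
  by move=> x y; rewrite !inE => /eqP lx /eqP ly /dart_eq; apply; rewrite lx.
rewrite -(card_in_imset inj_tail) -(card_ends (line d)); apply: eq_card => v.
apply/imsetP/idP => [[x] | ].
  by rewrite inE => /eqP<- ->; apply: tail_ends.
by case/(dart_of (lineP d)) => x <- lx; exists x; rewrite ?inE ?lx.
Qed.

Lemma turn_line_neq d : line (turn d) != line d.
Proof.
apply: contra (mate_neq card_tail d) => /eqP eq_line.
by apply/eqP/dart_eq; rewrite ?mate_fiber //; apply: card_tail.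
Qed.

Lemma tail_turn d : tail (turn d) = tail d.
Proof. exact: mate_fiber card_tail d. Qed.

Lemma line_flip d : line (flip d) = line d.
Proof. exact: mate_fiber card_line d. Qed.

Lemma tail_next d : tail (next d) \in ends (line d).
Proof. by rewrite tail_turn -line_flip tail_ends. Qed.

Lemma line_next_neq d : line (next d) != line d.
Proof. by rewrite -[line d]line_flip turn_line_neq. Qed.

Lemma ends_line d : ends (line d) = [set tail d; tail (next d)].
Proof.
apply/esym/eqP; rewrite eqEcard card_ends cards2 tail_turn.
have -> : tail d != tail (flip d).
  apply: contra (mate_neq card_line d) => /eqP eq_tail.
  by apply/eqP/dart_eq; rewrite ?mate_fiber //; apply: card_line.
rewrite andbT -[tail (flip d)]tail_turn; apply/subsetP=> v /set2P[] ->.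
  exact: tail_ends.
exact: tail_next.
Qed.

Lemma next_star d e : e \notin M -> tail (next d) \in ends e ->
  e = line d \/ e = line (next d).
Proof.
move=> eM /(dart_of eM)[d' td' <-].
have [-> | ->] := mateP card_tail td'; first by right.
by left; rewrite /next /turn (mateK card_tail) line_flip.
Qed.

Lemma next_inj : injective next.
Proof.
apply: inj_comp; first exact: can_inj (mateK card_tail).
exact: can_inj (mateK card_line).
Qed.

(** [turn d] leaves the same vertex in the opposite direction. This is what keeps an orbit of [next]
    from repeating a vertex or an edge. *)
Lemma turn_notin_orbit d : ~~ fconnect next d (turn d).
Proof.
apply: reflection_notin_orbit.
- exact: mateK card_tail.
- exact: mateK card_line.
- exact: mate_neq card_tail.
exact: mate_neq card_line.
Qed.

Lemma orbit_connect d x y :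
  x \in orbit next d -> y \in orbit next d -> fconnect next x y.
Proof.
rewrite -!fconnect_orbit => dx; apply: connect_trans.
by rewrite fconnect_sym //; apply: next_inj.
Qed.

Lemma cycle_in_dart_cycle d : cycle_in (~: M) (dart_cycle d).
Proof.
apply/and5P; split.
- by rewrite -size_eq0 size_map size_orbit -lt0n order_gt0.
- rewrite /unzip1 -map_comp map_inj_in_uniq ?orbit_uniq // => x y xd yd.
  move/esym/(mateP card_tail) => [-> // | yx].
  by have /negP[] := turn_notin_orbit x; rewrite -[turn x]yx (orbit_connect xd).
- rewrite /unzip2 -map_comp map_inj_in_uniq ?orbit_uniq // => x y xd yd.
  move/esym/(mateP card_line) => [-> // | yx].
  have /negP[] := turn_notin_orbit y.
  (* A repeated edge would give [y = flip x], so the orbit would contain both [y] and [turn y]. *)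
  have -> : turn y = next x by rewrite yx.
  by apply: connect_trans (fconnect1 _ _); apply: orbit_connect yd xd.
- by apply/allP=> _ /mapP[_ /mapP[x _ ->] ->]; rewrite /= inE lineP.
rewrite cycle_map; apply: sub_cycle (cycle_orbit next_inj d) => x y /eqP<-.
exact/eqP/ends_line.
Qed.

Lemma mem_dart_cycle_tail d v :
  reflect (exists2 x, fconnect next d x & v = tail x) (v \in unzip1 (dart_cycle d)).
Proof.
rewrite /dart_cycle /unzip1 -map_comp.
apply: (iffP mapP) => -[x dx vx]; exists x => //;
by rewrite -?fconnect_orbit // fconnect_orbit.
Qed.

Lemma mem_dart_cycle_line d e :
  reflect (exists2 x, fconnect next d x & e = line x) (e \in unzip2 (dart_cycle d)).
Proof.
rewrite /dart_cycle /unzip2 -map_comp.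
apply: (iffP mapP) => -[x dx ex]; exists x => //;
by rewrite -?fconnect_orbit // fconnect_orbit.
Qed.

Lemma fconnect_pred d x : fconnect next d x ->
  exists2 y, fconnect next d y & x = next y.
Proof.
move=> dx; exists (finv next x); last by rewrite f_finv //; apply: next_inj.
by apply: connect_trans dx (fconnect_finv _ _).
Qed.

(** * Alternation of a perfect matching along a cycle *)

Section Matching.

Variables (N X : {set edge G}).
Hypotheses (pmN : perfect_matching N) (defX : X = M :&: N).

(** The edge of [N] at an untouched vertex is outside [M], so it is exactly one of the two cycle
    edges there. *)
Lemma matching_next_untouched d : tail (next d) \notin touched X ->
  (line (next d) \in N) = (line d \notin N).
Proof.
move=> nX; have [e /andP[eN ve] e_uniq] := perfect_matchingP N pmN (tail (next d)).
have eM : e \notin M.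
  apply: contra nX => eM; apply/bigcupP; exists e => //.
  by rewrite defX inE eM.
have [Ee | Ee] := next_star eM ve; rewrite -Ee eN.
  apply/negP=> /e_uniq/(_ (tail_ends _))/eqP.
  by rewrite Ee (negPf (line_next_neq d)).
apply/esym/negP => /e_uniq/(_ (tail_next _))/eqP.
by rewrite Ee eq_sym (negPf (line_next_neq d)).
Qed.

Lemma matching_next_touched d : tail (next d) \in touched X -> line d \notin N.
Proof.
case/bigcupP=> e; rewrite defX inE => /andP[eM eN] ve.
have [e0 _ e_uniq] := perfect_matchingP N pmN (tail (next d)).
apply/negP=> dN; have /negP[] := lineP d.
by rewrite (e_uniq _ dN (tail_next d)) -(e_uniq e).
Qed.

Lemma untouched_alternate d k : line d \notin N ->
    (forall j, j < k -> tail (iter j.+1 next d) \notin touched X) ->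
  (line (iter k next d) \in N) = odd k.
Proof.
move=> dN; elim: k => [|k IHk] nX /=; first exact: negPf.
rewrite matching_next_untouched ?(nX k) // IHk // => j jk.
by apply: nX; apply: ltnW.
Qed.

(** The numbering starts at [next d], so the vertex of index [k] is entered along
    [line (iter k next d)]. Up to [v] no vertex is touched, so membership in [N] alternates from
    [line d] on; the edge entering [v] is not in [N], hence [k] is even. *)
Lemma hit_even d v : line d \notin N ->
    hits (touched X) (dart_cycle (next d)) = 1 ->
    v \in touched X -> v \in unzip1 (dart_cycle (next d)) ->
  ~~ odd (index v (unzip1 (dart_cycle (next d)))).
Proof.
move=> dN hit1 vX; set s := unzip1 _ => vs; set k := index v s.
have sz : size s = order next (next d) by rewrite /s !size_map size_orbit.
have uniq_s : uniq s by case/and5P: (cycle_in_dart_cycle (next d)).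
have tail_nth j : j < size s -> tail (iter j.+1 next d) = nth v s j.
  rewrite sz => lt_j; rewrite /s /dart_cycle /unzip1 -map_comp.
  by rewrite (nth_map (next d)) ?size_orbit // nth_traject // -iterSr.
have lt_k : k < size s by rewrite index_mem.
have tk : tail (iter k.+1 next d) = v by rewrite tail_nth // nth_index.
rewrite -(untouched_alternate dN) => [| j lt_jk].
  by apply: matching_next_touched; rewrite -iterS tk.
have lt_j := ltn_trans lt_jk lt_k.
(* A touched vertex [w] before [v] would be a second hit. *)
rewrite tail_nth //; apply/negP=> wX; set w := nth v s j in wX.
have ws : w \in s by apply: mem_nth.
have neq_wv : w != v.
  by apply: contraTneq lt_jk => wv; rewrite /k -wv index_uniq // ltnn.
suff: 1 < hits (touched X) (dart_cycle (next d)) by rewrite hit1.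
rewrite /hits -/s -size_filter -[1.+1]/(size [:: w; v]).
apply: uniq_leq_size => [|z]; first by rewrite /= inE neq_wv.
by rewrite !inE mem_filter => /pred2P[] ->; rewrite /= ?wX ?vX.
Qed.

End Matching.

(** * Replacing a matching on an untouched cycle *)

Section Exchange.

Variables (N1 N2 X1 X2 : {set edge G}) (d : dart).
Hypotheses (pmN1 : perfect_matching N1) (pmN2 : perfect_matching N2).
Hypotheses (defX1 : X1 = M :&: N1) (defX2 : X2 = M :&: N2).

Let c := dart_cycle d.

Hypotheses (hits1 : hits (touched X1) c = 0) (hits2 : hits (touched X2) c = 0).

Definition exchange : {set edge G} :=
  [set e | if e \in unzip2 (dart_cycle d) then e \notin N1 else e \in N2].

Lemma hits0_untouched (X : {set edge G}) x :
  hits (touched X) c = 0 -> fconnect next d x -> tail x \notin touched X.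
Proof.
move=> hits0 dx; apply/negP=> xX; suff: 0 < hits (touched X) c by rewrite hits0.
rewrite -has_count; apply/hasP; exists (tail x) => //.
by apply/mem_dart_cycle_tail; exists x.
Qed.

(** At a vertex of the cycle, [N1] contains exactly one of the two cycle edges, so its complement
    does too, and [N2] does not use the edge of [M]. A vertex off the cycle is on no cycle edge, so
    [N2] is unchanged there. *)
Lemma exchange_matching : perfect_matching exchange.
Proof.
apply/perfect_matchingP=> v.
have [/mem_dart_cycle_tail[x dx ->{v}] | vc] := boolP (v \in unzip1 c).
  have n1 := hits0_untouched hits1 dx; have n2 := hits0_untouched hits2 dx.
  have [y dy Ex] := fconnect_pred dx; rewrite Ex in n1 n2 dx *.
  have alt1 := matching_next_untouched pmN1 defX1 n1.
  have yc : line y \in unzip2 c by apply/mem_dart_cycle_line; exists y.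
  have nyc : line (next y) \in unzip2 c.
    by apply/mem_dart_cycle_line; exists (next y).
  have star e : e \in exchange -> tail (next y) \in ends e ->
      e = line y \/ e = line (next y).
    move=> eN' ve; apply: next_star => //; apply: contra n2 => eM.
    apply/bigcupP; exists e => //; rewrite defX2 inE eM.
    move: eN'; rewrite inE; case: ifP => // /mem_dart_cycle_line[z _ ez].
    by move: eM; rewrite ez (negPf (lineP z)).
  have [yN1 | yN1] := boolP (line y \in N1).
    exists (line (next y)); first by rewrite inE nyc alt1 yN1 tail_ends.
    move=> e eN' /(star e eN')[Ee | //].
    by move: eN'; rewrite inE Ee yc yN1.
  exists (line y); first by rewrite inE yc yN1 tail_next.
  move=> e eN' /(star e eN')[// | Ee].
  by move: eN'; rewrite inE Ee nyc alt1 yN1.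
have off e : v \in ends e -> e \notin unzip2 c.
  move=> ve; apply: contra vc => /mem_dart_cycle_line[x dx Ee].
  move: ve; rewrite Ee ends_line => /set2P[] ->; apply/mem_dart_cycle_tail.
    by exists x.
  by exists (next x) => //; apply: connect_trans dx (fconnect1 _ _).
have [e /andP[eN2 ve] e_uniq] := perfect_matchingP N2 pmN2 v.
exists e; first by rewrite inE (negPf (off e ve)) eN2 ve.
by move=> e' + ve'; rewrite inE (negPf (off e' ve')) => /e_uniq; apply.
Qed.

Lemma exchange_balanced : M :&: exchange = X2.
Proof.
rewrite defX2; apply/setP=> e; rewrite !inE.
case eM: (e \in M) => //=; case: ifP => // /mem_dart_cycle_line[x _ ex].
by move: eM; rewrite ex (negPf (lineP x)).
Qed.

End Exchange.

End TwoFactor.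

End Graph.

(** * A choice of matchings with maximal coverage *)

Theorem theorem5p2 (G : graph) (M A B C D : {set edge G}) :
  cubic G -> bridgeless G ->
  perfect_matching M ->
  all (balanced M) [:: A; B; C; D] ->
  pairwise (fun X Y : {set edge G} => [disjoint X & Y]) [:: A; B; C; D] ->
  (forall c, cycle_in (~: M) c -> odd (size c) ->
     all (fun X => hits (touched X) c == 1) [:: A; B; C; D] /\
     2 <= count odd (arc_lengths (touched (A :|: B :|: C :|: D)) c)) ->
  (forall c, cycle_in (~: M) c -> ~~ odd (size c) ->
     2 <= count (fun X => hits (touched X) c == 0) [:: A; B; C; D]) ->
  tau G <= 5.
Proof.
move=> cubG _ pmM balX _ odd_c even_c; apply/tau_le5 => //.
(* Indexing by ['I_4] keeps the four sets apart even if some of them are equal and empty. *)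
pose t := [tuple A; B; C; D]; pose X := tnth t.
have unionX : A :|: B :|: C :|: D = \bigcup_i X i.
  by rewrite !big_ord_recl big_ord0 setU0 !setUA.
pose valid (N : {ffun 'I_4 -> {set edge G}}) :=
  [forall i, perfect_matching (N i) && (X i == M :&: N i)].
have [N0 valid0] : exists N, valid N.
  have balXi i : exists N, perfect_matching N && (X i == M :&: N).
    by apply/existsP; apply: (allP balX); apply: (mem_tnth i t).
  exists [ffun i => xchoose (balXi i)]; apply/forallP=> i; rewrite ffunE.
  exact: xchooseP (balXi i).
(* Counting [M] as well would give the same maximizers, since each [M :&: N i] is fixed to be
   [X i]. *)
pose covered (N : {ffun 'I_4 -> {set edge G}}) := \bigcup_i N i.
case: (arg_maxnP (fun N => #|covered N|) valid0) => N validN maxN.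
have pmN i : perfect_matching (N i) by case/andP: (forallP validN i).
have defX i : X i = M :&: N i by case/andP: (forallP validN i) => _ /eqP.
exists (M |: [set N i | i : 'I_4]); last first.
  rewrite cardsU1 -[5]/(1 + 4) leq_add ?leq_b1 // -[X in _ <= X]card_ord.
  exact: leq_imset_card.
apply/andP; split.
  by apply/forall_inP=> _ /setU1P[-> | /imsetP[i _ ->]].
apply/eqP/setP=> e; rewrite inE; apply/bigcupP.
have [eM | eM] := boolP (e \in M); first by exists M; rewrite ?setU11.
have [/bigcupP[i _ eNi] | e_nc] := boolP (e \in covered N).
  by exists (N i); rewrite // inE imset_f ?orbT.
have eN i : e \notin N i by apply: contra e_nc => eNi; apply/bigcupP; exists i.
have [v ve] : exists v, v \in ends e by apply/card_gt0P; rewrite card_ends.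
have [d _ de] := dart_of eM ve; exfalso.
(* Starting at [next d] makes the uncovered edge [e] the last edge of the cycle. *)
have cyc := cycle_in_dart_cycle cubG pmM (next d).
have [odd_n | even_n] := boolP (odd (size (dart_cycle (next d)))).
  have [/allP hit1 odd_arcs] := odd_c _ cyc odd_n; move: odd_arcs.
  rewrite unionX ltnNge count_odd_arcs_le1 //; first by case/and5P: cyc.
  move=> w /bigcupP[f /bigcupP[i _ fX] wf]; have {}wf : w \in touched (X i).
    by apply/bigcupP; exists f.
  have dNi : line d \notin N i by rewrite de.
  apply: (hit_even cubG pmM (pmN i) (defX i) dNi) => //.
  by apply/eqP/hit1/(mem_tnth i t).
have := even_c _ cyc even_n.
rewrite -[[:: A; B; C; D]]/(val t) -[val t]map_tnth_enum count_map -size_filter.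
(* Two distinct indices [i], [j] whose sets do not touch the cycle. *)
rewrite enumT -cardE => /card_gt1P[i [j [/eqP hit_i /eqP hit_j neq_ij]]].
pose N' := [ffun k => if k == j then exchange (N i) (N j) (next d) else N k].
have /maxN : valid N'.
  apply/forallP=> k; rewrite ffunE; case: eqP => [-> | _].
    rewrite (exchange_matching cubG pmM (pmN i) (pmN j) (defX i) (defX j)) //.
    by rewrite (exchange_balanced _ _ (defX j)) eqxx.
  by rewrite pmN -defX eqxx.
suff : #|covered N| < #|covered N'| by rewrite ltnNge /= => /negP.
apply: proper_card; apply/properP; split; last first.
  (* The edge [e] is gained: it lies on the cycle and not in [N i]. *)
  exists e => //; apply/bigcupP; exists j => //.
  rewrite ffunE eqxx inE eN; case: ifP => // /negP[].
  apply/mem_dart_cycle_line; exists d => //.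
  by rewrite fconnect_sym ?fconnect1 //; apply: next_inj.
apply/subsetP=> f /bigcupP[k _ fNk]; apply/bigcupP.
(* No edge is lost: one that leaves [N j] is on the cycle and in [N i], which is kept because
   [i != j]. *)
have [fNi | fNi] := boolP (f \in N i).
  by exists i => //; rewrite ffunE (negPf neq_ij).
have [kj | kj] := eqVneq k j; last by exists k => //; rewrite ffunE (negPf kj).
by exists j => //; rewrite ffunE eqxx inE fNi -kj fNk; case: ifP.
Qed.
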